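(* Let $\lambda$ be a nonzero real number and let $r\ge 1$ be an integer. For every integer $n\ge 0$, $$D_{n,\lambda}^{(r)}=\frac{1}{\binom{n+r}{n}}S_{1,\lambda}(n+r,r).$$
   Context: Generating functions are power series in $t$ (formal, or convergent for $|t|$ small), with $(1+t)^{x}=\sum_{n\ge 0}(x)_n\frac{t^n}{n!}$, where $(x)_0=1$ and $(x)_n=x(x-1)\cdots(x-n+1)$ for $n\ge1$. Also $(x)_{0,\lambda}=1$ and $(x)_{n,\lambda}=x(x-\lambda)\cdots(x-(n-1)\lambda)$ for $n\ge 1$. The degenerate logarithm is $\log_\lambda(1+t)=\frac{1}{\lambda}\left((1+t)^\lambda-1\right)$. The degenerate Daehee polynomials of order $r$ are defined by $$\sum_{n=0}^{\infty}D_{n,\lambda}^{(r)}(x)\frac{t^{n}}{n!}=\left(\frac{\log(1+t)}{t}\right)^{r}\int_{0}^{1}\cdots\int_{0}^{1}(1+t)^{\lambda(x_{1}+\cdots+x_{r})+x}dx_{1}\cdots dx_{r}=\left(\frac{\log_{\lambda}(1+t)}{t}\right)^{r}(1+t)^{x},$$ and the degenerate Daehee numbers of order $r$ are $D_{n,\lambda}^{(r)}=D_{n,\lambda}^{(r)}(0)$. The degenerate Stirling numbers of the first kind $S_{1,\lambda}(n,l)$ are defined by the polynomial identity in $x$: $(x)_n=\sum_{l=0}^n S_{1,\lambda}(n,l)(x)_{l,\lambda}$ for $n\ge0$. *)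

(* Defs.v *)
From Stdlib Require Import Reals Factorial Lra Lia.
From Coquelicot Require Import Coquelicot.
Open Scope R_scope.

Fixpoint falling (x : R) (n : nat) : R :=
  match n with
  | O => 1
  | S k => falling x k * (x - INR k)
  end.

Fixpoint degenerate_falling (lambda x : R) (n : nat) : R :=
  match n with
  | O => 1
  | S k => degenerate_falling lambda x k * (x - INR k * lambda)
  end.

(* A formal power series is its sequence of coefficients, as in Coquelicot's
   [PS_mult], [PS_scal], [PS_decr_1]; the lemmas [degenerate_Daehee_is_pseries]
   and [degenerate_Daehee_integral] below show that for 0 < |t| < 1 the
   resulting series converges to the closed form of the generating function
   and to its expression as an integral over [0,1]^r. *)

Definition PS_one (n : nat) : R := match n with O => 1 | S _ => 0 end.

Fixpoint PS_pow (a : nat -> R) (r : nat) : nat -> R :=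
  match r with
  | O => PS_one
  | S k => PS_mult a (PS_pow a k)
  end.

(* (1 + t)^x *)
Definition PS_binomial (x : R) (n : nat) : R := falling x n / INR (fact n).

(* log_lambda (1 + t) = ((1 + t)^lambda - 1) / lambda *)
Definition PS_degenerate_log (lambda : R) : nat -> R :=
  PS_scal (/ lambda) (PS_minus (PS_binomial lambda) PS_one).

(* The constant coefficient of [PS_degenerate_log lambda] is 0, so [PS_decr_1]
   is exact division by t. *)
Definition PS_degenerate_Daehee (lambda : R) (r : nat) (x : R) : nat -> R :=
  PS_mult (PS_pow (PS_decr_1 (PS_degenerate_log lambda)) r) (PS_binomial x).

Definition degenerate_Daehee_poly (lambda : R) (r n : nat) (x : R) : R :=
  INR (fact n) * PS_degenerate_Daehee lambda r x n.

Definition degenerate_Daehee (lambda : R) (r n : nat) : R :=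
  degenerate_Daehee_poly lambda r n 0.

(* Values [S1 n l] with [l > n] are irrelevant. *)
Definition is_degenerate_Stirling1 (lambda : R) (S1 : nat -> nat -> R) : Prop :=
  forall (n : nat) (x : R),
    falling x n = sum_f_R0 (fun l => S1 n l * degenerate_falling lambda x l) n.

Lemma is_degenerate_Stirling1_ex (lambda : R) :
  exists S1, is_degenerate_Stirling1 lambda S1.
Proof.
pose (S1 := fix S1 (n l : nat) {struct n} : R :=
  match n with
  | O => match l with O => 1 | S _ => 0 end
  | S m => match l with O => 0 | S k => S1 m k end
           + (INR l * lambda - INR m) * S1 m l
  end).
assert (Hz : forall n l, (n < l)%nat -> S1 n l = 0).
{ induction n as [|n IH]; intros [|l] H; try lia; simpl; auto.
  fold (S1 n). rewrite !IH by lia. ring. }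
exists S1; intros n x; induction n as [|n IH]; [simpl; ring|].
assert (E : forall N, sum_f_R0 (fun l => S1 (S n) l * degenerate_falling lambda x l) (S N)
  = sum_f_R0 (fun l => S1 n l * degenerate_falling lambda x l) N * (x - INR n)
    + (INR (S N) * lambda - INR n) * S1 n (S N) * degenerate_falling lambda x (S N)).
{ induction N as [|N IHN].
  - simpl. ring.
  - rewrite tech5, IHN, (tech5 _ N).
    change (S1 (S n) (S (S N))) with
      (S1 n (S N) + (INR (S (S N)) * lambda - INR n) * S1 n (S (S N))).
    change (degenerate_falling lambda x (S (S N))) with
      (degenerate_falling lambda x (S N) * (x - INR (S N) * lambda)).
    ring. }
rewrite E, <- IH, (Hz n (S n)) by lia. simpl; ring.
Qed.

Lemma PS_radius_ge1 (a : nat -> R) :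
  (forall t, Rabs t < 1 -> ex_pseries a t) ->
  forall t, Rabs t < 1 -> Rbar_lt (Rabs t) (CV_radius a).
Proof.
intros H t Ht; apply Rbar_not_le_lt; intro Hle.
pose proof (Rabs_pos t).
assert (Hu : Rabs ((1 + Rabs t) / 2) = (1 + Rabs t) / 2) by (apply Rabs_pos_eq; lra).
apply (CV_disk_outside a ((1 + Rabs t) / 2)).
- rewrite Hu; apply Rbar_le_lt_trans with (1 := Hle); simpl; lra.
- apply ex_series_lim_0.
  destruct (H ((1 + Rabs t) / 2)) as [l Hl]; [rewrite Hu; lra|].
  exists l; apply is_pseries_R, Hl.
Qed.

Lemma PS_binomial_ex (x t : R) : Rabs t < 1 -> ex_pseries (PS_binomial x) t.
Proof.
intros Ht.
pose (M := Rabs x + 1).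
assert (HM : 0 < M) by (unfold M; pose proof (Rabs_pos x); lra).
pose (c := fix c n := match n with O => 1 | S k => c k * ((M + INR k) / INR (S k)) end).
assert (Hc : forall n, 0 < c n).
{ induction n as [|n IH]; [simpl; lra|].
  change (0 < c n * ((M + INR n) / INR (S n))).
  pose proof (pos_INR n). pose proof (lt_0_INR (S n) (Nat.lt_0_succ n)).
  apply Rmult_lt_0_compat; auto. apply Rdiv_lt_0_compat; lra. }
assert (Hb : forall n, Rabs (PS_binomial x n) <= c n).
{ induction n as [|n IH].
  - unfold PS_binomial; simpl. rewrite Rabs_pos_eq; lra.
  - pose proof (pos_INR n). pose proof (lt_0_INR (S n) (Nat.lt_0_succ n)).
    pose proof (INR_fact_neq_0 n).
    replace (PS_binomial x (S n)) with (PS_binomial x n * ((x - INR n) / INR (S n))).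
    + rewrite Rabs_mult. change (c (S n)) with (c n * ((M + INR n) / INR (S n))).
      apply Rmult_le_compat; auto using Rabs_pos.
      rewrite Rabs_div by lra. rewrite (Rabs_pos_eq (INR (S n))) by lra.
      apply Rmult_le_compat_r; [left; apply Rinv_0_lt_compat; lra|].
      unfold M, Rminus. eapply Rle_trans; [apply Rabs_triang|].
      rewrite Rabs_Ropp, (Rabs_pos_eq (INR n)); lra.
    + unfold PS_binomial. rewrite fact_simpl, mult_INR. simpl falling. field; lra. }
apply CV_disk_correct.
apply (@ex_series_le R_AbsRing R_CompleteNormedModule) with (b := fun n => Rabs (c n * t ^ n)).
- intro n. change (Rabs (Rabs (PS_binomial x n * t ^ n)) <= Rabs (c n * t ^ n)).
  rewrite Rabs_Rabsolu, !Rabs_mult.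
  apply Rmult_le_compat_r; [apply Rabs_pos|].
  rewrite (Rabs_pos_eq (c n)); [apply Hb|left; apply Hc].
- apply (CV_disk_DAlembert c t 1).
  + intro n; apply Rgt_not_eq, Hc.
  + apply is_lim_seq_ext with (fun n => 1 + (M - 1) * / INR (S n)).
    * intro n. pose proof (Hc n). pose proof (pos_INR n).
      pose proof (lt_0_INR (S n) (Nat.lt_0_succ n)).
      change (c (S n)) with (c n * ((M + INR n) / INR (S n))).
      replace (c n * ((M + INR n) / INR (S n)) / c n) with ((M + INR n) / INR (S n))
        by (field; lra).
      rewrite Rabs_pos_eq; [|apply Rlt_le, Rdiv_lt_0_compat; lra].
      rewrite S_INR in *. field; lra.
    * replace (Finite 1) with (Finite (1 + (M - 1) * 0)) by (f_equal; ring).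
      apply is_lim_seq_plus'; [apply is_lim_seq_const|].
      apply is_lim_seq_mult'; [apply is_lim_seq_const|].
      apply (is_lim_seq_incr_1 (fun n => / INR n)).
      apply (is_lim_seq_inv INR p_infty); [apply is_lim_seq_INR|discriminate].
  + right; split; [lra|rewrite Rinv_1; exact Ht].
Qed.

Lemma PS_binomial_is_pseries (x t : R) :
  Rabs t < 1 -> is_pseries (PS_binomial x) t (Rpower (1 + t) x).
Proof.
intros Ht.
assert (Hr := PS_radius_ge1 _ (PS_binomial_ex x)).
assert (HD : forall u, Rabs u < 1 ->
  (1 + u) * PSeries (PS_derive (PS_binomial x)) u = x * PSeries (PS_binomial x) u).
{ intros u Hu.
  assert (H1 : is_pseries (PS_derive (PS_binomial x)) u (PSeries (PS_derive (PS_binomial x)) u)).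
  { apply PSeries_correct, CV_radius_inside. rewrite CV_radius_derive. auto. }
  pose proof (is_pseries_plus _ _ _ _ _ H1 (is_pseries_incr_1 _ _ _ H1)) as H2.
  apply is_pseries_unique in H2.
  rewrite <- (PSeries_scal x).
  transitivity (PSeries (PS_plus (PS_derive (PS_binomial x))
                 (PS_incr_1 (PS_derive (PS_binomial x)))) u).
  - rewrite H2.
    change ((1 + u) * PSeries (PS_derive (PS_binomial x)) u
      = PSeries (PS_derive (PS_binomial x)) u + u * PSeries (PS_derive (PS_binomial x)) u).
    ring.
  - apply PSeries_ext. intros [|n].
    + change (1 * (1 * (x - 0) / 1) + 0 = x * (1 / 1)). field.
    + change (INR (S (S n)) * (falling x n * (x - INR n) * (x - INR (S n)) / INR (fact (S (S n))))
        + INR (S n) * (falling x n * (x - INR n) / INR (fact (S n)))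
        = x * (falling x n * (x - INR n) / INR (fact (S n)))).
      rewrite (fact_simpl (S n)), mult_INR.
      pose proof (INR_fact_neq_0 (S n)).
      pose proof (lt_0_INR (S (S n)) (Nat.lt_0_succ _)).
      field. split; lra. }
pose (g := fun u => PSeries (PS_binomial x) u * Rpower (1 + u) (- x)).
assert (Hg : forall u, Rabs u < 1 -> is_derive g u 0).
{ intros u Hu. pose proof (Rabs_def2 _ _ Hu) as [U1 U2].
  pose proof (is_derive_PSeries _ _ (Hr u Hu)) as H1.
  assert (H2 : is_derive (fun u => Rpower (1 + u) (- x)) u
                 (- x * / (1 + u) * Rpower (1 + u) (- x))).
  { unfold Rpower. auto_derive; [lra|]. field; lra. }
  pose proof (is_derive_mult _ _ _ _ _ H1 H2 Rmult_comm) as H3.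
  replace 0 with (plus (mult (PSeries (PS_derive (PS_binomial x)) u) (Rpower (1 + u) (- x)))
    (mult (PSeries (PS_binomial x) u) (- x * / (1 + u) * Rpower (1 + u) (- x)))); [exact H3|].
  unfold plus, mult; simpl.
  replace (PSeries (PS_derive (PS_binomial x)) u)
    with (x * PSeries (PS_binomial x) u / (1 + u)) by (rewrite <- HD by auto; field; lra).
  field; lra. }
assert (G0 : g 0 = 1).
{ unfold g. rewrite PSeries_0, Rplus_0_r. unfold PS_binomial, Rpower.
  rewrite ln_1, Rmult_0_r, exp_0. simpl. field. }
assert (Gt : g t = 1).
{ rewrite <- G0.
  destruct (MVT_gen g 0 t (fun _ => 0)) as [c [_ E]].
  - intros u Hu. apply Hg. apply Rabs_def2 in Ht.
    unfold Rmin, Rmax in Hu; destruct (Rle_dec 0 t); apply Rabs_def1; lra.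
  - intros u Hu. apply continuity_pt_filterlim.
    apply (ex_derive_continuous g). exists 0. apply Hg. apply Rabs_def2 in Ht.
    unfold Rmin, Rmax in Hu; destruct (Rle_dec 0 t); apply Rabs_def1; lra.
  - lra. }
replace (Rpower (1 + t) x) with (PSeries (PS_binomial x) t).
- apply PSeries_correct, PS_binomial_ex, Ht.
- unfold g in Gt. rewrite Rpower_Ropp in Gt.
  assert (0 < Rpower (1 + t) x) by apply exp_pos.
  apply (Rmult_eq_reg_r (/ Rpower (1 + t) x)).
  + rewrite Gt. field; lra.
  + apply Rgt_not_eq, Rinv_0_lt_compat; auto.
Qed.

Lemma PS_one_is_pseries (t : R) : Rabs t < 1 -> is_pseries PS_one t 1.
Proof.
intros Ht. apply Rabs_def2 in Ht as Ht'.
rewrite <- (Rpower_O (1 + t)) by lra.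
apply is_pseries_ext with (2 := PS_binomial_is_pseries 0 t Ht).
assert (H : forall n, falling 0 (S n) = 0).
{ induction n as [|n IH]; [simpl; ring|].
  change (falling 0 (S n) * (0 - INR (S n)) = 0). rewrite IH; apply Rmult_0_l. }
intros [|n]; unfold PS_binomial; [exact (Rdiv_diag 1 R1_neq_R0)|].
rewrite H; apply Rmult_0_l.
Qed.

Lemma PS_degenerate_log_quotient_ex (lambda t : R) :
  Rabs t < 1 -> ex_pseries (PS_decr_1 (PS_degenerate_log lambda)) t.
Proof.
intros Ht. apply ex_pseries_decr_1.
- destruct (Req_dec t 0) as [->|H]; [left; reflexivity|].
  right; exists (/ t). exact (Rinv_l t H).
- apply ex_pseries_scal; [apply Rmult_comm|]. apply ex_pseries_minus.
  + apply PS_binomial_ex, Ht.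
  + exists 1. apply PS_one_is_pseries, Ht.
Qed.

Lemma PS_degenerate_log_quotient_is_pseries (lambda t : R) :
  Rabs t < 1 -> t <> 0 ->
  is_pseries (PS_decr_1 (PS_degenerate_log lambda)) t
    (/ lambda * (Rpower (1 + t) lambda - 1) / t).
Proof.
intros Ht H0.
assert (H1 : is_pseries (PS_degenerate_log lambda) t
               (/ lambda * (Rpower (1 + t) lambda - 1))).
{ apply (is_pseries_scal (/ lambda) _ _ (Rpower (1 + t) lambda - 1)); [apply Rmult_comm|].
  apply (is_pseries_minus _ _ _ (Rpower (1 + t) lambda) 1).
  - apply PS_binomial_is_pseries, Ht.
  - apply PS_one_is_pseries, Ht. }
assert (Hy : mult (/ t) t = one) by exact (Rinv_l t H0).
pose proof (is_pseries_decr_1 _ _ _ _ Hy H1) as H2.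
replace (/ lambda * (Rpower (1 + t) lambda - 1) / t)
  with (scal (/ t) (plus (/ lambda * (Rpower (1 + t) lambda - 1))
          (opp (PS_degenerate_log lambda 0%nat)))); [exact H2|].
assert (E : PS_degenerate_log lambda 0%nat = 0).
{ change (/ lambda * (1 / 1 + - 1) = 0). rewrite Rdiv_diag by exact R1_neq_R0.
  rewrite Rplus_opp_r. apply Rmult_0_r. }
rewrite E. change (/ t * (/ lambda * (Rpower (1 + t) lambda - 1) + - 0)
  = / lambda * (Rpower (1 + t) lambda - 1) / t).
unfold Rdiv; ring.
Qed.

Lemma PS_mult_ex (a b : nat -> R) :
  (forall t, Rabs t < 1 -> ex_pseries a t) ->
  (forall t, Rabs t < 1 -> ex_pseries b t) ->
  forall t, Rabs t < 1 -> ex_pseries (PS_mult a b) t.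
Proof.
intros Ha Hb t Ht. eexists.
apply is_pseries_mult; auto using PSeries_correct, PS_radius_ge1.
Qed.

Lemma PS_pow_ex (a : nat -> R) (r : nat) :
  (forall t, Rabs t < 1 -> ex_pseries a t) ->
  forall t, Rabs t < 1 -> ex_pseries (PS_pow a r) t.
Proof.
intros Ha; induction r as [|r IH].
- intros t Ht; exists 1; apply PS_one_is_pseries, Ht.
- apply PS_mult_ex; auto.
Qed.

Lemma PS_pow_is_pseries (a : nat -> R) (r : nat) (t l : R) :
  (forall u, Rabs u < 1 -> ex_pseries a u) ->
  Rabs t < 1 -> is_pseries a t l -> is_pseries (PS_pow a r) t (l ^ r).
Proof.
intros Ha Ht Hl; induction r as [|r IH].
- apply PS_one_is_pseries, Ht.
- apply is_pseries_mult; auto using PS_radius_ge1, PS_pow_ex.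
Qed.

(* The integral of F (x_1 + ... + x_r) over [0,1]^r. *)
Fixpoint RInt_cube (r : nat) (F : R -> R) : R :=
  match r with
  | O => F 0
  | S k => RInt (fun y => RInt_cube k (fun s => F (y + s))) 0 1
  end.

Lemma RInt_cube_ext (r : nat) (F G : R -> R) :
  (forall s, F s = G s) -> RInt_cube r F = RInt_cube r G.
Proof.
revert F G; induction r as [|r IH]; intros F G H; simpl; auto.
apply RInt_ext; intros y _. apply IH; intro s; apply H.
Qed.

Lemma RInt_cube_Rpower (lambda u : R) (r : nat) (x : R) :
  lambda <> 0 -> ln u <> 0 ->
  RInt_cube r (fun s => Rpower u (lambda * s + x))
  = ((Rpower u lambda - 1) / (lambda * ln u)) ^ r * Rpower u x.
Proof.
intros Hl Hu. revert x; induction r as [|r IH]; intro x.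
- simpl. rewrite Rmult_0_r, Rplus_0_l. ring.
- simpl. set (K := (Rpower u lambda - 1) / (lambda * ln u)) in *.
  rewrite RInt_ext with (g := fun y => K ^ r * Rpower u (lambda * y + x)).
  2: { intros y _. rewrite <- IH. apply RInt_cube_ext; intro s. f_equal; ring. }
  apply is_RInt_unique.
  pose (f := fun y => K ^ r * Rpower u (lambda * y + x) / (lambda * ln u)).
  replace (K * K ^ r * Rpower u x) with (minus (f 1) (f 0)).
  + apply (is_RInt_derive f); intros y _.
    * unfold f, Rpower. auto_derive; auto. field; auto.
    * apply (ex_derive_continuous (fun y => K ^ r * Rpower u (lambda * y + x))).
      unfold Rpower. auto_derive; auto.
  + change (f 1 - f 0 = K * K ^ r * Rpower u x). unfold f.
    rewrite Rmult_0_r, Rplus_0_l, Rmult_1_r, Rpower_plus.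
    unfold K at 3. field; auto.
Qed.

Lemma degenerate_Daehee_integral (lambda : R) (r : nat) (x t : R) :
  lambda <> 0 -> Rabs t < 1 -> t <> 0 ->
  (ln (1 + t) / t) ^ r * RInt_cube r (fun s => Rpower (1 + t) (lambda * s + x))
  = (/ lambda * (Rpower (1 + t) lambda - 1) / t) ^ r * Rpower (1 + t) x.
Proof.
intros Hl Ht H0. apply Rabs_def2 in Ht as Ht'.
assert (Hu : ln (1 + t) <> 0).
{ rewrite <- ln_1. intro E. apply ln_inv in E; lra. }
rewrite RInt_cube_Rpower, <- Rmult_assoc, <- Rpow_mult_distr by auto.
f_equal; f_equal. field; auto.
Qed.

Lemma degenerate_Daehee_is_pseries (lambda : R) (r : nat) (x t : R) :
  Rabs t < 1 -> t <> 0 ->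
  is_pseries (fun n => degenerate_Daehee_poly lambda r n x / INR (fact n)) t
    ((/ lambda * (Rpower (1 + t) lambda - 1) / t) ^ r * Rpower (1 + t) x).
Proof.
intros Ht H0.
apply is_pseries_ext with (PS_degenerate_Daehee lambda r x).
- intro n. unfold degenerate_Daehee_poly.
  change (PS_degenerate_Daehee lambda r x n
    = INR (fact n) * PS_degenerate_Daehee lambda r x n / INR (fact n)).
  field. apply INR_fact_neq_0.
- pose proof (PS_degenerate_log_quotient_ex lambda) as Hq.
  apply is_pseries_mult.
  + apply PS_pow_is_pseries; auto using PS_degenerate_log_quotient_is_pseries.
  + apply PS_binomial_is_pseries, Ht.
  + apply PS_radius_ge1; auto. apply PS_pow_ex; auto.
  + apply PS_radius_ge1; auto. apply PS_binomial_ex.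
Qed.

(* Main.v *)
Require Import Defs.
From Stdlib Require Import Reals Factorial Wf_nat Compare_dec Lra Lia.
From Coquelicot Require Import Coquelicot.
Open Scope R_scope.

(** Write [L] for the degenerate logarithm of [1 + t].  Since
    [1 + lambda L = (1 + t)^lambda], raising to the power [m] and expanding by
    the binomial theorem gives, for every natural number [m],
    [(1 + t)^(m lambda) = sum_(l <= m) C(m,l) lambda^l L^l].  The coefficient
    [C(m,l) lambda^l] is [(m lambda)_(l,lambda) / l!], and [L^l] is [t^l] times
    the generating function of the Daehee numbers of order [l].  Comparing the
    coefficients of [t^N] expresses [(m lambda)_N] as a combination of the
    [(m lambda)_(l,lambda)], [l <= m], in which the Daehee numbers appear where
    the defining identity of the Stirling numbers, taken at [x = m lambda], has
    [S1 N l] ([coef_binomial_expansion]).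

    The values [(m lambda)_(l,lambda)] form a triangular array, zero for [l > m]
    and nonzero for [l = m], so the coefficients of such a combination are
    determined by its values at the points [m lambda]
    ([degenerate_falling_coef_unique]).  Equating the two families of
    coefficients at [l = r], [N = n + r] is the theorem.

    The comparison of coefficients is made on convergent series, by uniqueness
    of power series expansions on the disc [|t| < 1]. *)

(** * Degenerate falling factorials at multiples of lambda *)

Lemma degenerate_falling_multiple (lambda : R) (m l : nat) :
  (l <= m)%nat ->
  degenerate_falling lambda (INR m * lambda) l
  = INR (fact l) * (Binomial.C m l * lambda ^ l).
Proof.
intro H.
assert (E : degenerate_falling lambda (INR m * lambda) l * INR (fact (m - l))
            = INR (fact m) * lambda ^ l).
{ induction l as [|l IH]; [rewrite Nat.sub_0_r; simpl; ring|].
  simpl degenerate_falling. rewrite <- tech_pow_Rmult.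
  replace (INR (fact m) * (lambda * lambda ^ l))
    with (lambda * (INR (fact m) * lambda ^ l)) by ring.
  rewrite <- IH by lia.
  replace (m - l)%nat with (S (m - S l)) by lia.
  rewrite fact_simpl, mult_INR, S_INR, minus_INR, S_INR by lia. ring. }
unfold Binomial.C.
pose proof (INR_fact_neq_0 l). pose proof (INR_fact_neq_0 (m - l)).
apply (Rmult_eq_reg_r (INR (fact (m - l)))); auto.
rewrite E. field; auto.
Qed.

Lemma degenerate_falling_multiple_gt (lambda : R) (m l : nat) :
  (m < l)%nat -> degenerate_falling lambda (INR m * lambda) l = 0.
Proof.
induction l as [|l IH]; intro H; [lia|]. simpl.
destruct (Nat.eq_dec m l) as [<-|Hn]; [ring|].
rewrite IH by lia. ring.
Qed.

Lemma degenerate_falling_multiple_diag_neq_0 (lambda : R) (m : nat) :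
  lambda <> 0 -> degenerate_falling lambda (INR m * lambda) m <> 0.
Proof.
intro Hl. rewrite degenerate_falling_multiple, C_n_n, Rmult_1_l by lia.
apply Rmult_integral_contrapositive_currified;
  [apply INR_fact_neq_0|apply pow_nonzero, Hl].
Qed.

Lemma sum_f_R0_truncate (f : nat -> R) (m N : nat) :
  (m <= N)%nat -> (forall l, (m < l)%nat -> f l = 0) ->
  sum_f_R0 f N = sum_f_R0 f m.
Proof.
intros H Hf. induction H as [|N H IH]; auto.
rewrite tech5, IH, Hf by lia. ring.
Qed.

(** Evaluation at [0, lambda, 2 lambda, ...] is a triangular linear system with
    nonzero diagonal, so its solution is unique. *)
Lemma degenerate_falling_coef_unique (lambda : R) (a b : nat -> R) (N : nat) :
  lambda <> 0 ->
  (forall m, (m <= N)%nat ->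
     sum_f_R0 (fun l => a l * degenerate_falling lambda (INR m * lambda) l) m
     = sum_f_R0 (fun l => b l * degenerate_falling lambda (INR m * lambda) l) m) ->
  forall m, (m <= N)%nat -> a m = b m.
Proof.
intros Hl H m. induction m as [m IH] using lt_wf_ind. intro Hm.
apply (Rmult_eq_reg_r (degenerate_falling lambda (INR m * lambda) m));
  [|apply degenerate_falling_multiple_diag_neq_0, Hl].
specialize (H m Hm). destruct m as [|m]; [exact H|].
rewrite !tech5 in H.
rewrite (sum_eq _ (fun l => b l * degenerate_falling lambda (INR (S m) * lambda) l) m)
  in H by (intros l Hlm; rewrite IH by lia; reflexivity).
exact (Rplus_eq_reg_l _ _ _ H).
Qed.

(** * Series on the unit disc *)

Lemma is_pseries_sum_f_R0 (a : nat -> nat -> R) (k s : nat -> R) (t : R) (m : nat) :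
  (forall l, is_pseries (a l) t (s l)) ->
  is_pseries (fun N => sum_f_R0 (fun l => k l * a l N) m) t
    (sum_f_R0 (fun l => k l * s l) m).
Proof.
intro H. induction m as [|m IH]; simpl.
- apply (is_pseries_scal (k 0%nat) (a 0%nat)); [apply Rmult_comm|apply H].
- apply (is_pseries_plus _ (fun N => k (S m) * a (S m) N) _ _ (k (S m) * s (S m))
           IH).
  apply (is_pseries_scal (k (S m)) (a (S m))); [apply Rmult_comm|apply H].
Qed.

Lemma pseries_coef_unique (a b : nat -> R) (f : R -> R) :
  (forall t, Rabs t < 1 -> is_pseries a t (f t)) ->
  (forall t, Rabs t < 1 -> is_pseries b t (f t)) ->
  forall n, a n = b n.
Proof.
intros Ha Hb.
assert (Hr : forall c : nat -> R,
  (forall t, Rabs t < 1 -> is_pseries c t (f t)) -> Rbar_lt 0 (CV_radius c)).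
{ intros c Hc. assert (H0 : Rabs 0 = 0) by apply Rabs_R0.
  change (Rbar_lt (Finite 0) (CV_radius c)). rewrite <- H0.
  apply PS_radius_ge1; [|rewrite H0; lra].
  intros t Ht; exists (f t). apply Hc, Ht. }
intro n. apply PSeries_ext_recip; auto.
exists (mkposreal 1 Rlt_0_1). intros t Ht.
assert (Ht' : Rabs t < 1).
{ change (Rabs (t - 0) < 1) in Ht. rewrite Rminus_0_r in Ht. exact Ht. }
transitivity (f t); [|symmetry]; apply is_pseries_unique; auto.
Qed.

(** The closed form of the quotient of the degenerate logarithm by [t] is
    meaningless at [t = 0]; multiplied out by [t], it holds on the whole disc. *)
Lemma degenerate_log_quotient_mult (lambda t : R) :
  lambda <> 0 -> Rabs t < 1 ->
  lambda * (t * PSeries (PS_decr_1 (PS_degenerate_log lambda)) t) + 1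
  = Rpower (1 + t) lambda.
Proof.
intros Hl Ht. destruct (Req_dec t 0) as [->|H0].
- unfold Rpower. rewrite Rplus_0_r, ln_1, Rmult_0_r, exp_0. ring.
- rewrite (is_pseries_unique _ _ _
    (PS_degenerate_log_quotient_is_pseries lambda t Ht H0)).
  field; auto.
Qed.

Lemma degenerate_Daehee_numbers_is_pseries (lambda : R) (l : nat) (t : R) :
  Rabs t < 1 ->
  is_pseries (PS_degenerate_Daehee lambda l 0) t
    (PSeries (PS_decr_1 (PS_degenerate_log lambda)) t ^ l).
Proof.
intro Ht. pose proof (PS_degenerate_log_quotient_ex lambda) as Hq.
apply Rabs_def2 in Ht as Ht'.
rewrite <- (Rmult_1_r (_ ^ l)), <- (Rpower_O (1 + t)) by lra.
apply is_pseries_mult.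
- apply PS_pow_is_pseries; auto using PSeries_correct.
- apply PS_binomial_is_pseries, Ht.
- apply PS_radius_ge1; auto. apply PS_pow_ex; auto.
- apply PS_radius_ge1; auto. apply PS_binomial_ex.
Qed.

(** * Comparison of coefficients *)

(** The coefficients of [(1 + t)^(m lambda) = (1 + lambda L)^m], where [L] is
    the degenerate logarithm; the shift by [l] is the factor [t^l] of [L^l]. *)
Lemma coef_binomial_expansion (lambda : R) (m N : nat) :
  lambda <> 0 ->
  PS_binomial (INR m * lambda) N
  = sum_f_R0 (fun l => Binomial.C m l * lambda ^ l
      * PS_incr_n (PS_degenerate_Daehee lambda l 0) l N) m.
Proof.
intro Hl. revert N.
apply (pseries_coef_unique _ (fun N => sum_f_R0 (fun l => Binomial.C m l * lambda ^ l
      * PS_incr_n (PS_degenerate_Daehee lambda l 0) l N) m)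
  (fun t => Rpower (1 + t) (INR m * lambda))); intros t Ht.
- apply PS_binomial_is_pseries, Ht.
- set (q := PSeries (PS_decr_1 (PS_degenerate_log lambda)) t).
  replace (Rpower (1 + t) (INR m * lambda))
    with (sum_f_R0 (fun l => Binomial.C m l * lambda ^ l * (t ^ l * q ^ l)) m).
  + apply (is_pseries_sum_f_R0
      (fun l => PS_incr_n (PS_degenerate_Daehee lambda l 0) l)
      (fun l => Binomial.C m l * lambda ^ l) (fun l => t ^ l * q ^ l)).
    intro l. rewrite <- pow_n_pow.
    apply (is_pseries_incr_n (PS_degenerate_Daehee lambda l 0) l t (q ^ l)).
    apply degenerate_Daehee_numbers_is_pseries, Ht.
  + rewrite Rmult_comm, <- Rpower_mult, Rpower_pow by apply exp_pos.
    rewrite <- (degenerate_log_quotient_mult lambda t Hl Ht), binomial.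
    apply sum_eq; intros l _. fold q. rewrite pow1, !Rpow_mult_distr. ring.
Qed.

(** The degenerate Stirling numbers are the coefficients of the powers of the
    degenerate logarithm: [S1(N,l) = N!/l! [t^N] L^l]. *)
Lemma degenerate_Stirling1_coef (lambda : R) (S1 : nat -> nat -> R) (N l : nat) :
  lambda <> 0 -> is_degenerate_Stirling1 lambda S1 -> (l <= N)%nat ->
  S1 N l = INR (fact N) / INR (fact l)
           * PS_incr_n (PS_degenerate_Daehee lambda l 0) l N.
Proof.
intros Hl HS. revert l.
apply (degenerate_falling_coef_unique lambda (S1 N) (fun l => INR (fact N) / INR (fact l)
           * PS_incr_n (PS_degenerate_Daehee lambda l 0) l N) N Hl).
intros m Hm.
transitivity (falling (INR m * lambda) N).
- rewrite HS. symmetry. apply sum_f_R0_truncate; auto.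
  intros l Hml. rewrite degenerate_falling_multiple_gt by auto. apply Rmult_0_r.
- replace (falling (INR m * lambda) N)
    with (INR (fact N) * PS_binomial (INR m * lambda) N)
    by (unfold PS_binomial; field; apply INR_fact_neq_0).
  rewrite coef_binomial_expansion, scal_sum by auto.
  apply sum_eq; intros l Hlm.
  rewrite degenerate_falling_multiple by auto.
  field. apply INR_fact_neq_0.
Qed.

Theorem theorem3p1 :
  forall (lambda : R) (r : nat) (S1 : nat -> nat -> R),
    lambda <> 0 ->
    (1 <= r)%nat ->
    is_degenerate_Stirling1 lambda S1 ->
    forall n : nat,
      degenerate_Daehee lambda r n
      = 1 / Binomial.C (n + r) n * S1 (n + r)%nat r.
Proof.
intros lambda r S1 Hl _ HS n.
rewrite (degenerate_Stirling1_coef lambda S1 (n + r) r Hl HS) by lia.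
rewrite PS_incr_n_simplify.
destruct (le_lt_dec r (n + r)) as [_|H]; [|lia].
unfold degenerate_Daehee, degenerate_Daehee_poly, Binomial.C.
rewrite Nat.add_sub, (Nat.add_comm n r), Nat.add_sub.
field. repeat split; apply INR_fact_neq_0.
Qed.
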